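(* Let $\mathfrak l$ be an abelian Lie algebra and $(\mathfrak a,\omega_{\mathfrak a})$ a symplectic Lie algebra. For every quadratic extension $(\mathfrak g,\mathfrak j,i,p)$ of $\mathfrak l$ by $\mathfrak a$ there is a triple $(\gamma,\epsilon,\xi)\in Z^2(\mathfrak l,\mathfrak a,\omega_{\mathfrak a})$ such that $(\mathfrak g,\mathfrak j,i,p)$ is equivalent to $\mathfrak d_{\gamma,\epsilon,\xi}(\mathfrak l,\mathfrak a)$. Moreover, if $(\mathfrak g,\mathfrak j,i,p)$ is balanced, then the corresponding cocycle $(\gamma,\epsilon,\xi)$ is balanced, i.e. $(\gamma,\epsilon,\xi)\in Z^2(\mathfrak l,\mathfrak a,\omega_{\mathfrak a})_\sharp$.
   Context: All vector spaces and Lie algebras are real and finite-dimensional. A symplectic Lie algebra $(\mathfrak g,\omega)$ is a Lie algebra $\mathfrak g$ with a skew-symmetric non-degenerate bilinear form $\omega$ such that $\omega([X,Y],Z)+\omega([Y,Z],X)+\omega([Z,X],Y)=0$ for all $X,Y,Z$. An isomorphism of symplectic Lie algebras is a Lie algebra isomorphism $\varphi$ with $\varphi^*\omega_2=\omega_1$. Orthogonal complements ${}^\perp$ are with respect to $\omega$. A quadratic extension of an abelian Lie algebra $\mathfrak l$ by a symplectic Lie algebra $(\mathfrak a,\omega_{\mathfrak a})$ is a tuple $(\mathfrak g,\mathfrak j,i,p)$, where $(\mathfrak g,\omega_{\mathfrak g})$ is a symplectic Lie algebra with center $\mathfrak z$, $\mathfrak j\subset\mathfrak z$ is an isotropic ideal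 of $\mathfrak g$, and $i,p$ are Lie algebra homomorphisms forming a short exact sequence $0\to\mathfrak a\xrightarrow{i}\mathfrak g/\mathfrak j\xrightarrow{p}\mathfrak l\to0$ such that $\operatorname{im} i=\mathfrak j^\perp/\mathfrak j$ and $i:\mathfrak a\to\mathfrak j^\perp/\mathfrak j$ is an isomorphism of symplectic Lie algebras (for the induced form). It is balanced if $\mathfrak j=\mathfrak z\cap\mathfrak z^\perp$. Two quadratic extensions $(\mathfrak g_k,\mathfrak j_k,i_k,p_k)$, $k=1,2$, of $\mathfrak l$ by $\mathfrak a$ are equivalent if there is an isomorphism $\Phi:\mathfrak g_1\to\mathfrak g_2$ of symplectic Lie algebras with $\Phi(\mathfrak j_1)=\mathfrak j_2$ whose induced map $\overline\Phi:\mathfrak g_1/\mathfrak j_1\to\mathfrak g_2/\mathfrak j_2$ satisfies $\overline\Phi\circ i_1=i_2$ and $p_2\circ\overline\Phi=p_1$. Let $\gamma:\mathfrak l\to\operatorname{Hom}(\mathfrak a,\mathfrak l^* )$ and $\xi:\mathfrak l\to\operatorname{Hom}(\mathfrak a,\mathfrak a)$ be linear and $\epsilon:\mathfrak l\times\mathfrak l\to\mathfrak l^*$ alternating bilinear. Write $\gamma(L_1,A,L_2):=(\gamma(L_1)(A))(L_2)$. Define alternating bilinear maps $\alpha:\mathfrak l\times\mathfrak l\to\mathfrak a$, $\beta:\mathfrak a\times\mathfrak a\to\mathfrak l^*$ by $$\omega_{\mathfrak a}(\alpha(L_1,L_2),A)=\gamma(L_1,A,L_2)-\gamma(L_2,A,L_1),\qquad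 \beta(A_1,A_2)(L)=-\omega_{\mathfrak a}(\xi(L)A_1,A_2)-\omega_{\mathfrak a}(A_1,\xi(L)A_2).$$ $Z^2(\mathfrak l,\mathfrak a,\omega_{\mathfrak a})$ is the set of such triples with, for all $L,L_i\in\mathfrak l$, $A,A_i\in\mathfrak a$: (1) every $\xi(L)$ is a derivation of $\mathfrak a$, $\xi(L_1)\xi(L_2)-\xi(L_2)\xi(L_1)=\operatorname{ad}_{\mathfrak a}(\alpha(L_1,L_2))$, and $\xi(L_1)\alpha(L_2,L_3)+\xi(L_2)\alpha(L_3,L_1)+\xi(L_3)\alpha(L_1,L_2)=0$; (2) $\beta(\xi(L)A_1,A_2)+\beta(A_1,\xi(L)A_2)=\gamma(L)[A_1,A_2]_{\mathfrak a}$; (3) $\gamma(L_2)(\xi(L_1)A)-\gamma(L_1)(\xi(L_2)A)+\beta(\alpha(L_1,L_2),A)=0$; (4) $\gamma(L_1)\alpha(L_2,L_3)+\gamma(L_2)\alpha(L_3,L_1)+\gamma(L_3)\alpha(L_1,L_2)=0$; (5) $\epsilon(L_1,L_2)L_3+\epsilon(L_2,L_3)L_1+\epsilon(L_3,L_1)L_2=0$. For $(\gamma,\epsilon,\xi)\in Z^2(\mathfrak l,\mathfrak a,\omega_{\mathfrak a})$, $\mathfrak d_{\gamma,\epsilon,\xi}(\mathfrak l,\mathfrak a)$ is the symplectic Lie algebra $\mathfrak l^*\oplus\mathfrak a\oplus\mathfrak l$ with brackets $[\mathfrak l^*,\cdot]=0$, $[A_1,A_2]=\beta(A_1,A_2)+[A_1,A_2]_{\mathfrak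 a}$, $[L,A]=\gamma(L)A+\xi(L)A$, $[L_1,L_2]=\epsilon(L_1,L_2)+\alpha(L_1,L_2)$ and form $\omega(Z_1+A_1+L_1,Z_2+A_2+L_2)=Z_1(L_2)+\omega_{\mathfrak a}(A_1,A_2)-Z_2(L_1)$. The same symbol denotes the quadratic extension $(\mathfrak d_{\gamma,\epsilon,\xi}(\mathfrak l,\mathfrak a),\mathfrak l^*,i,p)$ of $\mathfrak l$ by $\mathfrak a$, where $\mathfrak d_{\gamma,\epsilon,\xi}(\mathfrak l,\mathfrak a)/\mathfrak l^*$ is identified with $\mathfrak a\oplus\mathfrak l$ and $i,p$ are the canonical embedding and projection. $Z^2(\mathfrak l,\mathfrak a,\omega_{\mathfrak a})_\sharp$ is the set of $(\gamma,\epsilon,\xi)\in Z^2(\mathfrak l,\mathfrak a,\omega_{\mathfrak a})$ (called balanced cocycles) such that (a) $L=0$ is the only $L\in\mathfrak l$ for which there is an $A\in\mathfrak a$ satisfying simultaneously $\operatorname{ad}_{\mathfrak a}(A)+\xi(L)=0$, $\gamma(L)+\beta(A,\cdot)=0$, $\alpha(L,L')=\xi(L')A$ and $\epsilon(L,L')=\gamma(L')A$ for all $L'\in\mathfrak l$; (b) the subspace $\{A\in\mathfrak z(\mathfrak a): \beta(A,\cdot)=0,\ \xi(L)A=0,\ \gamma(L)A=0\ \forall L\in\mathfrak l\}$ of $\mathfrak a$ is non-degenerate with respect to $\omega_{\mathfrak a}$ (the zero subspace counts as non-degenerate). *)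

(* Defs.v *)
From HB Require Import structures.
From mathcomp Require Import all_boot all_order all_algebra.
From mathcomp Require Import generic_quotient.
From mathcomp Require Import ring.
Set Implicit Arguments.
Unset Strict Implicit.
Unset Printing Implicit Defensive.
Import GRing.Theory.
Local Open Scope ring_scope.
Local Open Scope quotient_scope.

Section QuotientSpace.
Variables (K : fieldType) (V : vectType K) (U : {vspace V}).
Implicit Types x y : V.

(* The quotient space V / U: cosets are classes of the congruence modulo U,
   [repr] picks a representative and [piv] (below) is the projection. *)
Definition eqmodv x y := x - y \in U.

Lemma eqmodv_refl : reflexive eqmodv.
Proof. by move=> x; rewrite /eqmodv subrr mem0v. Qed.
Lemma eqmodv_sym : symmetric eqmodv.
Proof. by move=> x y; rewrite /eqmodv -memvN opprB. Qed.
Lemma eqmodv_trans : transitive eqmodv.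
Proof. by move=> y x z xy /(memvD xy); rewrite addrA subrK. Qed.
Canonical eqmodv_equiv := EquivRel eqmodv eqmodv_refl eqmodv_sym eqmodv_trans.

Definition quotv := {eq_quot eqmodv}.
HB.instance Definition _ := Choice.on quotv.
HB.instance Definition _ := EqQuotient.on quotv.

Lemma eq_quotv x y : (\pi_quotv x == \pi_quotv y) = (x - y \in U).
Proof. by rewrite piE. Qed.

Lemma repr_quotv x : repr (\pi_quotv x) - x \in U.
Proof. by rewrite -eq_quotv reprK. Qed.

Definition quotv_zero : quotv := \pi_quotv 0.
Definition quotv_opp (u : quotv) : quotv := \pi_quotv (- repr u).
Definition quotv_add (u v : quotv) : quotv := \pi_quotv (repr u + repr v).
Definition quotv_scale (k : K) (u : quotv) : quotv := \pi_quotv (k *: repr u).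

Lemma pi_quotv_opp x : quotv_opp (\pi_quotv x) = \pi_quotv (- x).
Proof.
by apply/eqP; rewrite eq_quotv -opprD memvN repr_quotv.
Qed.
Lemma pi_quotv_add x y : quotv_add (\pi_quotv x) (\pi_quotv y) = \pi_quotv (x + y).
Proof.
by apply/eqP; rewrite eq_quotv opprD addrACA memvD ?repr_quotv.
Qed.
Lemma pi_quotv_scale k x : quotv_scale k (\pi_quotv x) = \pi_quotv (k *: x).
Proof. by apply/eqP; rewrite eq_quotv -scalerBr memvZ ?repr_quotv. Qed.

Let pi_ind (P : quotv -> Prop) : (forall x, P (\pi_quotv x)) -> forall u, P u.
Proof. by move=> Pp u; rewrite -[u]reprK. Qed.

Lemma quotv_addA : associative quotv_add.
Proof.
elim/pi_ind=> x; elim/pi_ind=> y; elim/pi_ind=> z.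
by rewrite !pi_quotv_add addrA.
Qed.
Lemma quotv_addC : commutative quotv_add.
Proof. by elim/pi_ind=> x; elim/pi_ind=> y; rewrite !pi_quotv_add addrC. Qed.
Lemma quotv_add0 : left_id quotv_zero quotv_add.
Proof. by elim/pi_ind=> x; rewrite pi_quotv_add add0r. Qed.
Lemma quotv_addN : left_inverse quotv_zero quotv_opp quotv_add.
Proof. by elim/pi_ind=> x; rewrite pi_quotv_opp pi_quotv_add addNr. Qed.
HB.instance Definition _ :=
  GRing.isZmodule.Build quotv quotv_addA quotv_addC quotv_add0 quotv_addN.

Lemma quotv_scaleA k k' u :
  quotv_scale k (quotv_scale k' u) = quotv_scale (k * k') u.
Proof. by elim/pi_ind: u => x; rewrite !pi_quotv_scale scalerA. Qed.
Lemma quotv_scale1 : left_id 1 quotv_scale.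
Proof. by elim/pi_ind=> x; rewrite pi_quotv_scale scale1r. Qed.
Lemma quotv_scaleDr : right_distributive quotv_scale +%R.
Proof.
move=> k; elim/pi_ind=> x; elim/pi_ind=> y.
by rewrite [X in quotv_scale k X]pi_quotv_add !pi_quotv_scale scalerDr [RHS]pi_quotv_add.
Qed.
Lemma quotv_scaleDl u : {morph quotv_scale^~ u : k k' / k + k'}.
Proof.
move=> k k'; elim/pi_ind: u => x.
by rewrite !pi_quotv_scale scalerDl [RHS]pi_quotv_add.
Qed.
HB.instance Definition _ := GRing.Zmodule_isLmodule.Build K quotv
  quotv_scaleA quotv_scale1 quotv_scaleDr quotv_scaleDl.

Lemma pi_quotv_is_linear : linear (\pi_quotv : V -> quotv).
Proof. by move=> k x y; rewrite -pi_quotv_add -pi_quotv_scale. Qed.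
HB.instance Definition _ := GRing.isLinear.Build K V quotv _ \pi_quotv pi_quotv_is_linear.

Let cpl (u : quotv) : subvs_of U^C := vsproj U^C (daddv_pi U^C U (repr u)).
Let cpl0 : (U^C :&: U = 0)%VS. Proof. by rewrite capvC capv_compl. Qed.
Let cplE x : cpl (\pi_quotv x) = vsproj U^C (daddv_pi U^C U x).
Proof.
apply/eqP; rewrite -subr_eq0 -!linearB /=.
have := daddv_pi_add cpl0 (w := repr (\pi_quotv x) - x).
rewrite addvC addv_complf memvf => /(_ isT).
rewrite (daddv_pi_id _ (repr_quotv x)) ?capv_compl // => /(canRL (addrK _)).
by rewrite subrr => ->; rewrite linear0.
Qed.
Let cpl_linear : linear cpl.
Proof.
move=> k; elim/pi_ind=> x; elim/pi_ind=> y.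
by rewrite -linearP !cplE !linearP.
Qed.
Let cpl_bij : bijective cpl.
Proof.
exists (fun w => \pi_quotv (vsval w)) => [|w]; last first.
  by rewrite cplE daddv_pi_id ?subvsP // vsvalK.
elim/pi_ind=> x; apply/eqP; rewrite cplE eq_quotv vsprojK ?memv_pi //.
have := daddv_pi_add cpl0 (w := x).
rewrite addvC addv_complf memvf => /(_ isT) {2}<-.
by rewrite opprD addNKr memvN memv_pi.
Qed.
Lemma quotv_vect_axiom : Vector.axiom (\dim U^C) quotv.
Proof.
have [f flin fbij] := subvs_vect_iso U^C.
exists (f \o cpl); last exact: bij_comp.
by move=> k u v; rewrite /= cpl_linear flin.
Qed.
HB.instance Definition _ := Lmodule_hasFinDim.Build K quotv quotv_vect_axiom.

Definition piv : 'Hom(V, quotv) := linfun \pi_quotv.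
Lemma pivE x : piv x = \pi_quotv x. Proof. exact: lfunE. Qed.

End QuotientSpace.

Lemma linfunE (K : fieldType) (U V : vectType K) (f : U -> V) :
  linear f -> linfun f =1 f.
Proof.
move=> lin u; pose h := GRing.isLinear.Build K U V _ _ lin.
pose g : {linear U -> V} := HB.pack f h.
exact: (lfunE g).
Qed.

Section Curry.
Variables (K : fieldType) (U V W : vectType K).

(* Linear maps into a Hom space are curried bilinear maps. *)
Definition curry_lfun (f : {bilinear U -> V -> W}) : 'Hom(U, 'Hom(V, W)) :=
  linfun (fun u => linfun (f u)).

Lemma curry_lfunE f u v : curry_lfun f u v = f u v.
Proof.
rewrite linfunE ?lfunE // => k x y; apply/lfunP => z.
by do !rewrite lfunE /=; exact: linearPl.
Qed.

End Curry.

Section LieAlgebra.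
Variable K : fieldType.

Structure lieAlgebra := LieAlgebra {
  lie_vect :> vectType K;
  br : {bilinear lie_vect -> lie_vect -> lie_vect};
  br_alt : forall x, br x x = 0;
  br_jacobi : forall x y z, br x (br y z) + br y (br z x) + br z (br x y) = 0
}.

Definition lie_abelian (g : lieAlgebra) := forall x y : g, br g x y = 0.

Definition lie_hom (g h : lieAlgebra) (f : 'Hom(g, h)) :=
  forall x y, f (br g x y) = br h (f x) (f y).

Definition lie_ideal (g : lieAlgebra) (j : {vspace g}) :=
  forall x y, y \in j -> br g x y \in j.

Definition ad (g : lieAlgebra) : 'Hom(g, 'End(g)) := curry_lfun (br g).

Definition lie_center (g : lieAlgebra) : {vspace g} := lker (ad g).

Lemma br_anti (g : lieAlgebra) (x y : g) : br g x y = - br g y x.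
Proof.
apply/eqP; rewrite -addr_eq0; have := br_alt (x + y).
by rewrite linearDl !linearDr !br_alt add0r addr0 => ->.
Qed.

Lemma lie_centerP (g : lieAlgebra) (x : g) :
  reflect (forall y, br g x y = 0) (x \in lie_center g).
Proof.
rewrite memv_ker; apply: (iffP eqP) => [ad0 y|brx0].
  by rewrite -curry_lfunE -/(ad g) ad0 lfunE.
by apply/lfunP => y; rewrite curry_lfunE brx0 lfunE.
Qed.

End LieAlgebra.

Section QuotientLie.
Variables (K : fieldType) (g : lieAlgebra K) (j : {vspace g}).
Hypothesis jP : lie_ideal j.

Definition quot_br (u v : quotv j) : quotv j := piv j (br g (repr u) (repr v)).

Lemma quot_brE x y : quot_br (piv j x) (piv j y) = piv j (br g x y).
Proof.
apply/eqP; rewrite /quot_br !pivE eq_quotv.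
set x' := repr _; set y' := repr _.
have -> : br g x' y' - br g x y = br g x' (y' - y) - br g y (x' - x).
  rewrite !linearBr /= (br_anti y x') (br_anti y x) !opprK.
  by rewrite opprD opprK addrA subrK.
by rewrite memvB ?jP ?repr_quotv.
Qed.

Lemma quot_br_bilinear : bilinear_for *:%R *:%R quot_br.
Proof.
split=> w k u v; rewrite -[w]reprK -[u]reprK -[v]reprK -!pivE -linearP !quot_brE.
  by rewrite linearPl linearP.
by rewrite linearPr linearP.
Qed.
HB.instance Definition _ := bilinear_isBilinear.Build K (quotv j) (quotv j)
  (quotv j) *:%R *:%R quot_br quot_br_bilinear.

Lemma quot_br_alt u : quot_br u u = 0.
Proof. by rewrite -[u]reprK -pivE quot_brE br_alt linear0. Qed.

Lemma quot_br_jacobi u v w :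
  quot_br u (quot_br v w) + quot_br v (quot_br w u) + quot_br w (quot_br u v) = 0.
Proof.
rewrite -[u]reprK -[v]reprK -[w]reprK -!pivE !quot_brE -!linearD.
by rewrite br_jacobi linear0.
Qed.

Definition lie_quot : lieAlgebra K := LieAlgebra quot_br_alt quot_br_jacobi.

End QuotientLie.


Section SymplecticLie.
Variable K : fieldType.

Structure symplLie := SymplLie {
  sl_lie :> lieAlgebra K;
  omega : {skew_symmetric sl_lie};
  omega_nondeg : nondegenerate omega;
  omega_closed : forall x y z,
    omega (br _ x y) z + omega (br _ y z) x + omega (br _ z x) y = 0
}.

Lemma omega_anti (g : symplLie) (x y : g) : omega g x y = - omega g y x.
Proof. by rewrite [LHS]hermitian_subproof expr1 mulN1r. Qed.

Lemma omega_inj (g : symplLie) (x y : g) :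
  (forall z, omega g x z = omega g y z) -> x = y.
Proof.
move=> exy; apply/eqP; rewrite -subr_eq0 -memv0 -(eqP (omega_nondeg g)).
by apply/mem_orthovP => z _; rewrite linearBl /= exy subrr.
Qed.

Definition sympl_iso (g h : symplLie) (f : 'Hom(g, h)) :=
  [/\ bijective f, lie_hom f & forall x y, omega h (f x) (f y) = omega g x y].

Definition flat (g : symplLie) : 'Hom(g, 'Hom(g, K^o)) :=
  linfun (fun x => linfun (omega g x : g -> K^o)).

Lemma flatE (g : symplLie) (x y : g) : flat g x y = omega g x y.
Proof.
rewrite linfunE ?lfunE // => k u v; apply/lfunP => z.
by do !rewrite lfunE /=; exact: linearPl.
Qed.

Lemma flat_inj (g : symplLie) : lker (flat g) == 0%VS.
Proof.
apply/lker0P => x y fxy; apply: omega_inj => z.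
by rewrite -!flatE fxy.
Qed.

(* The vector representing a functional through the nondegenerate omega. *)
Definition sharp (g : symplLie) (phi : 'Hom(g, K^o)) : g := ((flat g)^-1)%VF phi.

Lemma dim_dual (V : vectType K) : dim 'Hom(V, K^o) = dim V.
Proof. by rewrite /dim /= muln1. Qed.

Lemma sharpE (g : symplLie) phi y : omega g (sharp phi) y = phi y.
Proof.
rewrite -flatE limg_lfunVK //.
suff -> : limg (flat g) = fullv by rewrite memvf.
apply/eqP; rewrite eqEdim subvf limg_dim_eq ?(eqP (flat_inj g)) ?capv0 //.
by rewrite !dimvf dim_dual leqnn.
Qed.

End SymplecticLie.

Section InducedForm.
Variables (K : fieldType) (g : symplLie K) (j : {vspace g}).

(* Restricts to the form induced on j^perp / j when j is isotropic (lemma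
   [induced_omegaE]); outside that subspace the value depends on [repr]. *)
Definition induced_omega (u v : quotv j) : K := omega g (repr u) (repr v).

Let addv_sub (x y : g) : x - y \in j -> exists2 u, u \in j & x = u + y.
Proof. by exists (x - y); rewrite ?subrK. Qed.

Lemma induced_omegaE x y :
    (j <= orthov (omega g) j)%VS ->
    x \in orthov (omega g) j -> y \in orthov (omega g) j ->
  induced_omega (piv j x) (piv j y) = omega g x y.
Proof.
move=> /orthovP jj /mem_orthovP xj /mem_orthovP yj; rewrite /induced_omega !pivE.
have /addv_sub [u uj ->] := repr_quotv j x.
have /addv_sub [v vj ->] := repr_quotv j y.
rewrite linearDl !linearDr /= (jj _ _ uj vj) (xj _ vj) omega_anti (yj _ uj).
by rewrite oppr0 !add0r.
Qed.

End InducedForm.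

Section InducedMap.
Variables (K : fieldType) (V W : vectType K).
Variables (U : {vspace V}) (U' : {vspace W}).

(* The map V / U -> W / U' induced by f; meaningful when f maps U into U'
   (lemma [induced_mapE]). *)
Definition induced_map (f : 'Hom(V, W)) : 'Hom(quotv U, quotv U') :=
  linfun (fun u : quotv U => piv U' (f (repr u))).

Lemma induced_mapE (f : 'Hom(V, W)) x :
  (f @: U <= U')%VS -> induced_map f (piv U x) = piv U' (f x).
Proof.
move=> fU.
have fpi y : piv U' (f (repr (piv U y))) = piv U' (f y).
  apply/eqP; rewrite !pivE eq_quotv -linearB /=.
  by apply: (subvP fU); rewrite memv_img ?repr_quotv.
rewrite linfunE ?fpi // => k u v.
by rewrite -[u]reprK -[v]reprK -!pivE -linearP !fpi !linearP.
Qed.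

End InducedMap.

Section QuadraticExtension.
Variables (K : fieldType) (l : lieAlgebra K) (a : symplLie K).

(* The last two fields, with [qe_i_hom] and [qe_i_inj], say that i is an
   isomorphism of symplectic Lie algebras from a onto j^perp / j. *)
Structure quadExt := QuadExt {
  qe_alg :> symplLie K;
  qe_sub : {vspace qe_alg};
  qe_ideal : lie_ideal qe_sub;
  qe_central : (qe_sub <= lie_center qe_alg)%VS;
  qe_isotropic : (qe_sub <= orthov (omega qe_alg) qe_sub)%VS;
  qe_i : 'Hom(a, lie_quot qe_ideal);
  qe_p : 'Hom(lie_quot qe_ideal, l);
  qe_i_hom : lie_hom qe_i;
  qe_p_hom : lie_hom qe_p;
  qe_i_inj : lker qe_i = 0%VS;
  qe_exact : limg qe_i = lker qe_p;
  qe_p_surj : limg qe_p = fullv;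
  qe_i_img : limg qe_i = (piv qe_sub @: orthov (omega qe_alg) qe_sub)%VS;
  qe_i_omega : forall A B,
    induced_omega (qe_i A : quotv qe_sub) (qe_i B) = omega a A B
}.

Arguments qe_ideal : clear implicits.

Definition qe_balanced (E : quadExt) :=
  qe_sub E = (lie_center E :&: orthov (omega E) (lie_center E))%VS.

Definition qe_equiv (E1 E2 : quadExt) :=
  exists f : 'Hom(E1, E2),
    let fbar : 'Hom(lie_quot (qe_ideal E1), lie_quot (qe_ideal E2)) :=
      induced_map (qe_sub E1) (qe_sub E2) f in
    [/\ sympl_iso f, (f @: qe_sub E1)%VS = qe_sub E2,
        forall A, fbar (qe_i E1 A) = qe_i E2 A &
        forall u, qe_p E2 (fbar u) = qe_p E1 u].

End QuadraticExtension.
Arguments qe_ideal {K l a} q.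

Lemma scaleoE (R : comNzRingType) (k x : R) : k *: (x : R^o) = k * x.
Proof. by []. Qed.

Section Cocycles.
Variables (K : fieldType) (l : lieAlgebra K) (a : symplLie K).

Structure cochain := Cochain {
  cc_gam : 'Hom(l, 'Hom(a, 'Hom(l, K^o)));
  cc_eps : {bilinear l -> l -> 'Hom(l, K^o)};
  cc_xi : 'Hom(l, 'End(a));
  cc_eps_alt : forall L, cc_eps L L = 0
}.

Variable c : cochain.
Local Notation gam := (cc_gam c).
Local Notation eps := (cc_eps c).
Local Notation xi := (cc_xi c).
Implicit Types (L : l) (A B : a).

(* alpha L1 L2 is the vector determined by [alphaE]; likewise [betaE] is the
   defining formula of beta. *)
Definition cc_alpha L1 L2 : a :=
  sharp (linfun (fun A => gam L1 A L2 - gam L2 A L1 : K^o)).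

Definition cc_beta A1 A2 : 'Hom(l, K^o) :=
  linfun (fun L => - omega a (xi L A1) A2 - omega a A1 (xi L A2) : K^o).

Lemma alphaE L1 L2 A :
  omega a (cc_alpha L1 L2) A = gam L1 A L2 - gam L2 A L1.
Proof.
rewrite sharpE linfunE // => k x y; rewrite !linearP /= !lfunE /= !lfunE /=.
by rewrite !scaleoE; ring.
Qed.

Lemma betaE A1 A2 L :
  cc_beta A1 A2 L = - omega a (xi L A1) A2 - omega a A1 (xi L A2).
Proof.
rewrite linfunE // => k x y; rewrite !linearP /= !lfunE /= !lfunE /=.
by rewrite linearPl linearPr /= !scaleoE; ring.
Qed.

Let lfunsE := (add_lfunE, opp_lfunE, scale_lfunE).

Lemma alphaPl L : linear (cc_alpha ^~ L).
Proof.
move=> k x y; apply: omega_inj => z; rewrite linearPl /= !alphaE !linearP /=.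
rewrite !lfunsE /= !scaleoE; ring.
Qed.

Lemma alphaC L1 L2 : cc_alpha L1 L2 = - cc_alpha L2 L1.
Proof.
by apply: omega_inj => z; rewrite linearNl /= !alphaE opprB.
Qed.

Lemma alphaPr L : linear (cc_alpha L).
Proof.
by move=> k x y; rewrite alphaC alphaPl opprD -scalerN -!alphaC.
Qed.

Lemma alpha_alt L : cc_alpha L L = 0.
Proof. by apply: omega_inj => z; rewrite alphaE subrr linear0l. Qed.

Lemma betaC A B : cc_beta A B = - cc_beta B A.
Proof.
apply/lfunP => L; rewrite opp_lfunE !betaE.
rewrite (omega_anti (xi L A)) (omega_anti A) !opprK.
by rewrite opprD !opprK addrC.
Qed.

Lemma betaPl A : linear (cc_beta ^~ A).
Proof.
move=> k x y; apply/lfunP => L; rewrite !lfunsE !betaE !linearP /=.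
by rewrite !linearPl /= !scaleoE; ring.
Qed.

Lemma betaPr A : linear (cc_beta A).
Proof.
by move=> k x y; rewrite betaC betaPl opprD -scalerN -!betaC.
Qed.

Lemma beta_alt A : cc_beta A A = 0.
Proof.
by apply/lfunP => L; rewrite betaE lfunE /= (omega_anti A) opprK addNr.
Qed.

HB.instance Definition _ := bilinear_isBilinear.Build K l l a *:%R *:%R
  cc_alpha (alphaPl, alphaPr).
HB.instance Definition _ := bilinear_isBilinear.Build K a a 'Hom(l, K^o)
  *:%R *:%R cc_beta (betaPl, betaPr).

Record cocycle : Prop := {
  cocycle_derivation : forall L A B,
    xi L (br a A B) = br a (xi L A) B + br a A (xi L B);
  cocycle_curvature : forall L1 L2 A,
    xi L1 (xi L2 A) - xi L2 (xi L1 A) = br a (cc_alpha L1 L2) A;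
  cocycle_alpha : forall L1 L2 L3,
    xi L1 (cc_alpha L2 L3) + xi L2 (cc_alpha L3 L1) + xi L3 (cc_alpha L1 L2) = 0;
  cocycle_beta : forall L A B,
    cc_beta (xi L A) B + cc_beta A (xi L B) = gam L (br a A B);
  cocycle_gam_xi : forall L1 L2 A,
    gam L2 (xi L1 A) - gam L1 (xi L2 A) + cc_beta (cc_alpha L1 L2) A = 0;
  cocycle_gam_alpha : forall L1 L2 L3,
    gam L1 (cc_alpha L2 L3) + gam L2 (cc_alpha L3 L1) + gam L3 (cc_alpha L1 L2) = 0;
  cocycle_eps : forall L1 L2 L3, eps L1 L2 L3 + eps L2 L3 L1 + eps L3 L1 L2 = 0
}.

End Cocycles.

Section TwistedSum.
Variables (K : fieldType) (l : lieAlgebra K) (a : symplLie K).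
Variable c : cochain l a.
Local Notation gam := (cc_gam c).
Local Notation eps := (cc_eps c).
Local Notation xi := (cc_xi c).
Local Notation alpha := (cc_alpha c).
Local Notation beta := (cc_beta c).
Hypothesis cP : cocycle c.

Let lfunsE := (add_lfunE, opp_lfunE, scale_lfunE).

(* l^* (+) a (+) l. *)
Definition d_vect : vectType K := ('Hom(l, K^o) * (a * l))%type.

Definition d_br (x y : d_vect) : d_vect :=
  let: (_, (A1, L1)) := x in let: (_, (A2, L2)) := y in
  (beta A1 A2 + gam L1 A2 - gam L2 A1 + eps L1 L2,
   (br a A1 A2 + xi L1 A2 - xi L2 A1 + alpha L1 L2, 0)).

Definition d_omega (x y : d_vect) : K :=
  let: (Z1, (A1, L1)) := x in let: (Z2, (A2, L2)) := y in
  Z1 L2 + omega a A1 A2 - Z2 L1.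

Ltac gen_atoms :=
  repeat match goal with
  | |- context [fun_of_lfun (fun_of_lfun (cc_gam c) ?x) ?y] =>
      generalize (gam x y); intro
  | |- context [cc_beta c ?x ?y] => generalize (beta x y); intro
  | |- context [Bilinear.sort (cc_eps c) ?x ?y] => generalize (eps x y); intro
  end.

Lemma eps_anti L1 L2 : eps L1 L2 = - eps L2 L1.
Proof.
apply/eqP; rewrite -addr_eq0; have := cc_eps_alt c (L1 + L2).
by rewrite linearDl !linearDr /= !cc_eps_alt add0r addr0 => ->.
Qed.

Lemma d_br_alt x : d_br x x = 0.
Proof.
case: x => Z [A L]; rewrite /d_br beta_alt alpha_alt br_alt cc_eps_alt.
by rewrite !add0r !subrr !addr0.
Qed.

Lemma d_br_anti x y : d_br x y = - d_br y x.
Proof.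
case: x y => [Z1 [A1 L1]] [Z2 [A2 L2]]; rewrite /d_br.
rewrite betaC eps_anti alphaC br_anti.
congr (_, (_, _)); last by rewrite oppr0.
- by rewrite !opprD !opprK [_ + gam _ _ - _]addrAC.
- by rewrite !opprD !opprK [_ + xi _ _ - _]addrAC.
Qed.

Lemma d_br_linear x : linear (d_br x).
Proof.
case: x => Z [A L] k [Z1 [A1 L1]] [Z2 [A2 L2]].
congr (_, (_, _)); last by rewrite /= scaler0 addr0.
- rewrite /= betaPr linearPr !linearP /= !lfunsE.
  gen_atoms; apply/lfunP => L'; rewrite !lfunsE !scaleoE; ring.
- rewrite /= alphaPr linearPr !linearP /= !lfunsE.
  apply: omega_inj => B; rewrite ?(linearDl, linearNl, linearZl_LR) /=; ring.
Qed.

Lemma d_br_bilinear : bilinear_for *:%R *:%R d_br.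
Proof.
split=> [y k u v|x]; last exact: d_br_linear.
by rewrite d_br_anti d_br_linear opprD -scalerN -!d_br_anti.
Qed.
HB.instance Definition _ := bilinear_isBilinear.Build K d_vect d_vect
  d_vect *:%R *:%R d_br d_br_bilinear.

Lemma d_omega_anti x y : d_omega x y = - d_omega y x.
Proof.
case: x y => [Z1 [A1 L1]] [Z2 [A2 L2]] /=.
by rewrite omega_anti; ring.
Qed.

Lemma d_omega_scalar x : scalar (d_omega x).
Proof.
case: x => Z [A L] k [Z1 [A1 L1]] [Z2 [A2 L2]] /=.
by rewrite linearPr !linearP /= !lfunsE !scaleoE; ring.
Qed.

Lemma d_omega_bilinear : bilinear_for *%R (idfun \; *%R) d_omega.
Proof.
split=> [y k u v|x]; last exact: d_omega_scalar.
by rewrite d_omega_anti d_omega_scalar opprD -mulrN -!d_omega_anti.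
Qed.
HB.instance Definition _ := bilinear_isBilinear.Build K d_vect d_vect K
  *%R (idfun \; *%R) d_omega d_omega_bilinear.
Lemma d_omega_skew x y :
  d_omega x y = (-1) ^+ true * idfun (d_omega y x).
Proof. by rewrite expr1 mulN1r; exact: d_omega_anti. Qed.
HB.instance Definition _ := isHermitianSesquilinear.Build K d_vect true idfun
  d_omega d_omega_skew.

Lemma beta_closed A1 A2 A3 :
  beta A1 (br a A2 A3) + beta A2 (br a A3 A1) + beta A3 (br a A1 A2) = 0.
Proof.
apply/lfunP => L; rewrite !lfunsE zero_lfunE !betaE !(cocycle_derivation cP).
rewrite !linearDr /= !(omega_anti _ (br _ _ _)) !opprK.
rewrite -[RHS](addr0 0) -{1}(omega_closed (xi L A1) A2 A3).
rewrite -[X in _ = _ + X](addr0 0) -{1}(omega_closed (xi L A2) A3 A1).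
by rewrite -(omega_closed (xi L A3) A1 A2); ring.
Qed.

Lemma dual_sep (V : vectType K) (v : V) :
  (forall phi : 'Hom(V, K^o), phi v = 0) -> v = 0.
Proof.
move=> phi0; rewrite (coord_vbasis (memvf v)) big1 // => i _.
have := phi0 (linfun (coord (vbasis fullv) i : V -> K^o)).
by rewrite lfunE /= => ->; rewrite scale0r.
Qed.

Lemma d_nondeg : nondegenerate (d_omega : {skew_symmetric d_vect}).
Proof.
rewrite /nondegenerate -subv0; apply/subvP => -[Z [A L]] /mem_orthovP o.
have Z0 : Z = 0.
  apply/lfunP => L'; have := o (0, (0, L')) (memvf _).
  by rewrite /= !zero_lfunE linear0r addr0 subr0.
have A0 : A = 0.
  apply: omega_inj => B; have := o (0, (B, 0)) (memvf _).
  by rewrite /= zero_lfunE linear0l linear0 add0r subr0.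
suff L0 : L = 0 by rewrite Z0 A0 L0 mem0v.
apply: dual_sep => phi; have := o (phi, (0, 0)) (memvf _).
by rewrite /= linear0r linear0 addr0 add0r => /eqP; rewrite oppr_eq0 => /eqP.
Qed.

Lemma d_omega_closed x y z :
  d_omega (d_br x y) z + d_omega (d_br y z) x
    + d_omega (d_br z x) y = 0.
Proof.
case: x y z => [Z1 [A1 L1]] [[Z2 [A2 L2]] [Z3 [A3 L3]]] /=.
have h1 := cocycle_eps cP L1 L2 L3.
have h2 := omega_closed A1 A2 A3.
rewrite !lfunsE !linear0 !betaE ?(linearDl, linearNl) /= !alphaE.
rewrite (omega_anti A1 (xi L3 A2)) (omega_anti A2 (xi L1 A3)).
rewrite (omega_anti A3 (xi L2 A1)).
by rewrite -[RHS](addr0 0) -[X in _ = X + _]h1 -[X in _ = _ + X]h2; ring.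
Qed.

Lemma d_br_jacobi x y z :
  d_br x (d_br y z) + d_br y (d_br z x)
    + d_br z (d_br x y) = 0.
Proof.
case: x y z => [Z1 [A1 L1]] [[Z2 [A2 L2]] [Z3 [A3 L3]]] /=.
congr (_, (_, _)); rewrite /= ?addr0 //.
- rewrite !linear0 !zero_lfunE ?linear0r !subr0 !addr0 !(linearDr, linearNr) /=.
  rewrite !(linearD, linearN) /= -!(cocycle_beta cP).
  rewrite !(betaC _ _ (alpha _ _)) !(betaC _ _ (xi _ _)).
  have h L L' A : beta (alpha L L') A = gam L (xi L' A) - gam L' (xi L A).
    apply/eqP; rewrite -subr_eq0 opprB addrC; apply/eqP.
    exact: cocycle_gam_xi cP L L' A.
  rewrite !h -[RHS](addr0 0) -[X in _ = X + _](beta_closed A1 A2 A3).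
  rewrite -[X in _ = _ + X](cocycle_gam_alpha cP L1 L2 L3).
  gen_atoms; apply/lfunP => L; rewrite !lfunsE; ring.
- rewrite !linear0 !zero_lfunE ?linear0r !subr0 !addr0 !(linearDr, linearNr) /=.
  rewrite !(linearD, linearN) /= !(cocycle_derivation cP).
  rewrite !(br_anti _ (alpha _ _)) !(br_anti _ (xi _ _)).
  rewrite -!(cocycle_curvature cP) -[RHS](addr0 0).
  rewrite -[X in _ = X + _](br_jacobi A1 A2 A3).
  rewrite -[X in _ = _ + X](cocycle_alpha cP L1 L2 L3).
  apply: omega_inj => B.
  rewrite !(linearDl, linearNl) /=.
  ring.
Qed.

Definition d_lie : lieAlgebra K :=
  @LieAlgebra K d_vect d_br d_br_alt d_br_jacobi.

Definition d_sympl : symplLie K :=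
  @SymplLie K d_lie d_omega d_nondeg d_omega_closed.

(* The summand l^*. *)
Definition dual_sub : {vspace d_sympl} :=
  limg (linfun (fun Z : 'Hom(l, K^o) => (Z, (0, 0)) : d_sympl)).

Lemma mem_dual_sub (x : d_sympl) : (x \in dual_sub) = (x.2 == 0).
Proof.
have lin : linear (fun Z : 'Hom(l, K^o) => (Z, (0, 0)) : d_sympl).
  by move=> k Z Z'; congr (_, (_, _)); rewrite /= scaler0 addr0.
apply/memv_imgP/eqP => [[Z _ ->]|]; first by rewrite linfunE.
by case: x => Z [A L] /= [-> ->]; exists Z; rewrite ?memvf ?linfunE.
Qed.

Lemma dual_sub_central : (dual_sub <= lie_center d_sympl)%VS.
Proof.
apply/subvP => x; rewrite mem_dual_sub => /eqP x0; apply/lie_centerP => y.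
case: x x0 y => Z [A L] [-> ->] [Z' [A' L']] /=.
by rewrite /d_br !linear0 !zero_lfunE !linear0l !addr0.
Qed.

Lemma dual_sub_ideal : lie_ideal dual_sub.
Proof.
move=> x y /(subvP dual_sub_central)/lie_centerP yc.
by rewrite br_anti yc oppr0 mem0v.
Qed.

Lemma mem_orth_dual_sub (x : d_sympl) :
  (x \in orthov (omega d_sympl) dual_sub) = (x.2.2 == 0).
Proof.
apply/mem_orthovP/eqP => [xj|x0 y].
  case: x xj => Z [A L] /= xj; apply: dual_sep => phi.
  have /xj : ((phi, (0, 0)) : d_sympl) \in dual_sub by rewrite mem_dual_sub.
  rewrite /= linear0r linear0 addr0 add0r => /eqP.
  by rewrite oppr_eq0 => /eqP.
rewrite mem_dual_sub; case: x y x0 => Z [A L] [Z' [A' L']] /= -> /eqP[-> ->].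
by rewrite !linear0 ?linear0r !addr0.
Qed.

Lemma dual_sub_isotropic :
  (dual_sub <= orthov (omega d_sympl) dual_sub)%VS.
Proof.
apply/subvP => x; rewrite mem_dual_sub mem_orth_dual_sub.
by case: x => Z [A L] /eqP[_ ->].
Qed.

(* The embedding of a in, and the projection onto l from, the quotient by l^*,
   which is identified with a (+) l. *)
Definition d_i : 'Hom(a, lie_quot dual_sub_ideal) :=
  linfun (fun A => piv dual_sub ((0, (A, 0)) : d_sympl)).

Definition d_p : 'Hom(lie_quot dual_sub_ideal, l) :=
  linfun (fun u : quotv dual_sub => (repr u).2.2).

Lemma d_iE A : d_i A = piv dual_sub ((0, (A, 0)) : d_sympl).
Proof.
rewrite linfunE // => k x y; rewrite -linearP; congr (piv _ _).
by congr (_, (_, _)); rewrite /= scaler0 addr0.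
Qed.

Lemma d_pE (x : d_sympl) : d_p (piv dual_sub x) = x.2.2.
Proof.
have ppi (y : d_sympl) : (repr (piv dual_sub y)).2.2 = y.2.2.
  have := repr_quotv dual_sub y; rewrite mem_dual_sub -pivE.
  by move/eqP/(congr1 snd)/eqP; rewrite /= subr_eq0 => /eqP.
rewrite linfunE ?ppi // => k u v.
by rewrite -[u]reprK -[v]reprK -!pivE -linearP !ppi.
Qed.

Hypothesis label : lie_abelian l.

Lemma d_i_hom : lie_hom d_i.
Proof.
move=> A B; rewrite !d_iE /= quot_brE; last exact: dual_sub_ideal.
apply/eqP; rewrite !pivE eq_quotv mem_dual_sub /=.
by rewrite !linear0 !zero_lfunE ?linear0r !addr0 subr0 subrr.
Qed.

Lemma d_p_hom : lie_hom d_p.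
Proof.
move=> u v; rewrite label -[u]reprK -[v]reprK -!pivE /= quot_brE.
  by rewrite d_pE; case: (repr u) (repr v) => [? [? ?]] [? [? ?]].
exact: dual_sub_ideal.
Qed.

Lemma d_i_inj : lker d_i = 0%VS.
Proof.
apply/eqP/lker0P => A B; rewrite !d_iE !pivE => /eqP.
rewrite eq_quotv mem_dual_sub => /eqP/(congr1 fst)/eqP /=.
by rewrite subr_eq0 => /eqP.
Qed.

Lemma d_i_img : limg d_i =
  (piv dual_sub @: orthov (omega d_sympl) dual_sub)%VS.
Proof.
apply/vspaceP => u; apply/memv_imgP/memv_imgP => -[x xP ->].
  exists (0, (x, 0)); last exact: d_iE.
  by rewrite mem_orth_dual_sub.
exists x.2.1; rewrite ?memvf //; apply/eqP.
rewrite d_iE !pivE eq_quotv mem_dual_sub.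
move: xP; rewrite mem_orth_dual_sub; case: x => Z [A L] /= /eqP ->.
by rewrite subrr.
Qed.

Lemma d_exact : limg d_i = lker d_p.
Proof.
rewrite d_i_img; apply/vspaceP => u; rewrite memv_ker.
apply/memv_imgP/eqP => [[x + ->]|].
  by rewrite mem_orth_dual_sub d_pE => /eqP.
rewrite -[u]reprK -pivE d_pE => u0; exists (repr u) => //.
by rewrite mem_orth_dual_sub u0.
Qed.

Lemma d_p_surj : limg d_p = fullv.
Proof.
apply/eqP; rewrite eqEsubv subvf; apply/subvP => L _; apply/memv_imgP.
exists (piv dual_sub ((0, (0, L)) : d_sympl)); rewrite ?memvf //.
by rewrite d_pE.
Qed.

Lemma d_i_omega A B :
  induced_omega (d_i A : quotv dual_sub) (d_i B) = omega a A B.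
Proof.
rewrite !d_iE induced_omegaE ?mem_orth_dual_sub ?dual_sub_isotropic //=.
by rewrite zero_lfunE add0r subr0.
Qed.

Definition d_ext : quadExt l a :=
  QuadExt dual_sub_central dual_sub_isotropic d_i_hom d_p_hom
    d_i_inj d_exact d_p_surj d_i_img d_i_omega.

End TwistedSum.

(* W stands for a subspace; W = 0 is nondegenerate. *)
Definition nondegenerate_on (K : fieldType) (g : symplLie K) (W : g -> Prop) :=
  forall x, W x -> (forall y, W y -> omega g x y = 0) -> x = 0.

Section BalancedCocycle.
Variables (K : fieldType) (l : lieAlgebra K) (a : symplLie K).
Variable c : cochain l a.
Local Notation gam := (cc_gam c).
Local Notation eps := (cc_eps c).
Local Notation xi := (cc_xi c).
Local Notation alpha := (cc_alpha c).
Local Notation beta := (cc_beta c).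

Record balanced_cocycle : Prop := {
  balanced_cocycleP : cocycle c;
  balanced_a : forall L : l,
    (exists A : a,
      [/\ ad a A + xi L = 0,
          forall A', gam L A' + beta A A' = 0,
          forall L', alpha L L' = xi L' A &
          forall L', eps L L' = gam L' A]) ->
    L = 0;
  balanced_b : nondegenerate_on (fun A : a =>
    [/\ A \in lie_center a, forall A', beta A A' = 0,
        forall L, xi L A = 0 & forall L, gam L A = 0])
}.

End BalancedCocycle.

(* Main.v *)
(* Lift l to an isotropic complement s(l) of j^perp in g, embed l^* in g as
   j = j^perp^perp through omega, and lift a into j^perp orthogonally to s(l).
   In the resulting decomposition g = l^* + a + l the form is the standard one,
   and closedness of omega forces the components of the bracket to be those of
   d_{gamma,epsilon,xi}; the cocycle identities are then the components of the
   Jacobi identity and of closedness.  Being balanced is invariant under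
   equivalence, and for d_{gamma,epsilon,xi} conditions (a) and (b) are read off
   from the elements A + L of the center, which determine it modulo l^*. *)
Require Import Defs.
From HB Require Import structures.
From mathcomp Require Import all_boot all_order all_algebra.
From mathcomp Require Import ring.
From mathcomp Require Import reals.
Set Implicit Arguments.
Unset Strict Implicit.
Unset Printing Implicit Defensive.
Import GRing.Theory.
Local Open Scope ring_scope.

(** * Linear algebra of non-degenerate forms *)

Lemma comp_lfun_linearl (K : fieldType) (U V W : vectType K) (f : 'Hom(U, V)) :
  linear (fun h : 'Hom(V, W) => (h \o f)%VF).
Proof. by move=> k x y; rewrite comp_lfunDl comp_lfunZl. Qed.

Lemma sharp_linear (K : fieldType) (g : symplLie K) :
  linear (@sharp K g).
Proof. by move=> k x y; rewrite /sharp linearP. Qed.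

Lemma piv_eq0 (K : fieldType) (V : vectType K) (U : {vspace V}) (x : V) :
  (piv U x == 0) = (x \in U).
Proof.
have <- : piv U 0 = 0 by exact: linear0.
by rewrite !pivE eq_quotv subr0.
Qed.

(** A functional on the quotient by [U], pulled back to [g], is represented through [omega] by a
    vector of the orthogonal of [U]. Hence all such functionals vanish on the class of a vector of
    the double orthogonal, and that class is zero. *)
Lemma orthov_orthov_sub (K : fieldType) (g : symplLie K) (U : {vspace g}) :
  (orthov (omega g) (orthov (omega g) U) <= U)%VS.
Proof.
apply/subvP => x /mem_orthovP x_orth; rewrite -piv_eq0; apply/eqP.
apply: dual_sep => phi.
have phiE y : omega g (sharp (phi \o piv U)%VF) y = phi (piv U y).
  by rewrite sharpE comp_lfunE.
have /x_orth : sharp (phi \o piv U)%VF \in orthov (omega g) U.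
  apply/mem_orthovP => u; rewrite phiE -piv_eq0 => /eqP ->.
  by rewrite linear0.
by rewrite omega_anti phiE => /eqP; rewrite oppr_eq0 => /eqP.
Qed.

Definition pull_form (K : fieldType) (U V : vectType K) (g : symplLie K)
    (f : 'Hom(U, g)) (h : 'Hom(V, g)) : 'Hom(U, 'Hom(V, K^o)) :=
  linfun (fun u => (flat g (f u) \o h)%VF).

Lemma pull_formE (K : fieldType) (U V : vectType K) (g : symplLie K)
    (f : 'Hom(U, g)) (h : 'Hom(V, g)) u v :
  pull_form f h u v = omega g (f u) (h v).
Proof.
rewrite linfunE ?comp_lfunE ?flatE // => k x y.
by rewrite !linearP comp_lfun_linearl.
Qed.

Lemma d_omega_inj (K : fieldType) (l : lieAlgebra K) (a : symplLie K)
    (u v : d_vect l a) :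
  (forall w, d_omega u w = d_omega v w) -> u = v.
Proof.
move=> e; apply/eqP; rewrite -subr_eq0 -memv0 -(eqP (d_nondeg l a)).
by apply/mem_orthovP => w _; rewrite linearBl /= e subrr.
Qed.

(** * Cocycle identities from Jacobi and closedness *)

Section CocycleOfJacobi.
Variables (K : fieldType) (l : lieAlgebra K) (a : symplLie K).
Variable c : cochain l a.
Hypothesis jacobi : forall u v w,
  d_br c u (d_br c v w) + d_br c v (d_br c w u) + d_br c w (d_br c u v) = 0.
Hypothesis closed : forall u v w,
  d_omega (d_br c u v) w + d_omega (d_br c v w) u + d_omega (d_br c w u) v = 0.

(** Evaluate on vectors taken from the summands a and l: the a-components of Jacobi give (1), the
    l^*-components give (2) to (4). Since l^* is central, [eps] drops out of Jacobi, and (5) comes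
    from closedness on three vectors of l. *)
Lemma cocycle_of_jacobi : cocycle c.
Proof.
have zeroE := (add0r, addr0, sub0r).
split.
- move=> L A B; case: (jacobi (0, (A, 0)) (0, (B, 0)) (0, (0, L))) => _ + _.
  rewrite /= !(linear0, linear0r, linear0l, zero_lfunE, zeroE) linearNr /=.
  rewrite (br_anti B) -opprD addrC => /eqP.
  by rewrite subr_eq0 => /eqP ->; rewrite addrC.
- move=> L1 L2 A; case: (jacobi (0, (0, L1)) (0, (0, L2)) (0, (A, 0))) => _ + _.
  rewrite /= !(linear0, linear0r, linear0l, zero_lfunE, zeroE) linearN /=.
  by rewrite (br_anti A) => /eqP; rewrite subr_eq0 => /eqP.
- move=> L1 L2 L3.
  case: (jacobi (0, (0, L1)) (0, (0, L2)) (0, (0, L3))) => _ + _.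
  by rewrite /= !(linear0, linear0r, linear0l, zero_lfunE, zeroE).
- move=> L A B; case: (jacobi (0, (A, 0)) (0, (B, 0)) (0, (0, L))) => + _ _.
  rewrite /= !(linear0, linear0r, linear0l, zero_lfunE, zeroE) linearNr /=.
  rewrite (betaC _ B) -opprD addrC => /eqP.
  by rewrite subr_eq0 => /eqP ->; rewrite addrC.
- move=> L1 L2 A; case: (jacobi (0, (0, L1)) (0, (0, L2)) (0, (A, 0))) => + _ _.
  rewrite /= !(linear0, linear0r, linear0l, zero_lfunE, zeroE) linearN /=.
  rewrite (betaC _ A) => /eqP.
  by rewrite subr_eq0 => /eqP <-; rewrite addrA subrK subrr.
- move=> L1 L2 L3.
  case: (jacobi (0, (0, L1)) (0, (0, L2)) (0, (0, L3))) => + _ _.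
  by rewrite /= !(linear0, linear0r, linear0l, zero_lfunE, zeroE).
- move=> L1 L2 L3.
  have := closed (0, (0, L1)) (0, (0, L2)) (0, (0, L3)).
  rewrite /= !(linear0, linear0r, linear0l, zero_lfunE, zeroE).
  by rewrite ?subr0.
Qed.

End CocycleOfJacobi.

(** * Identification of a split symplectic Lie algebra with l^* + a + l *)

Section Splitting.
Variables (K : fieldType) (l : lieAlgebra K) (a g : symplLie K).
Variables (pr : 'Hom(g, l)) (q : 'Hom('Hom(l, K^o), g)).
Variables (t : 'Hom(a, g)) (s : 'Hom(l, g)).

Record splitting : Prop := {
  split_pr_br : forall x y, pr (br g x y) = 0;
  split_omega_q : forall Z x, omega g (q Z) x = Z (pr x);
  split_q_central : forall Z x, br g (q Z) x = 0;
  split_pr_q : forall Z, pr (q Z) = 0;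
  split_pr_t : forall A, pr (t A) = 0;
  split_pr_s : forall L, pr (s L) = L;
  split_omega_ss : forall L L', omega g (s L) (s L') = 0;
  split_omega_ts : forall A L, omega g (t A) (s L) = 0;
  split_omega_tt : forall A B, omega g (t A) (t B) = omega a A B;
  split_br_tt : forall A B C,
    omega g (br g (t A) (t B)) (t C) = omega a (br a A B) C;
  split_qts_full : forall x, exists Z A L, x = q Z + t A + s L
}.

Hypothesis sp : splitting.
Let pr_br := split_pr_br sp.
Let omega_q := split_omega_q sp.
Let q_central := split_q_central sp.
Let pr_q := split_pr_q sp.
Let pr_t := split_pr_t sp.
Let pr_s := split_pr_s sp.
Let omega_ss := split_omega_ss sp.
Let omega_ts := split_omega_ts sp.
Let omega_tt := split_omega_tt sp.
Let br_tt := split_br_tt sp.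
Let qts_full := split_qts_full sp.

Definition glue : 'Hom(d_vect l a, g) :=
  linfun (fun x : d_vect l a => q x.1 + t x.2.1 + s x.2.2).

Lemma glueE x : glue x = q x.1 + t x.2.1 + s x.2.2.
Proof.
rewrite linfunE // => k u v; rewrite !linearP /=.
by rewrite !scalerDr (addrACA (k *: q _)) [LHS]addrACA.
Qed.

(** The adjoint of [glue] for the two symplectic forms, see [unglue_adj]: pairing [x] with s(l)
    gives its l^*-component, pairing with t(a) its a-component. *)
Definition unglue : 'Hom(g, d_vect l a) :=
  linfun (fun x : g => ((flat g x \o s)%VF, (sharp (flat g x \o t)%VF, pr x))
    : d_vect l a).

Lemma unglueE x :
  unglue x = ((flat g x \o s)%VF, (sharp (flat g x \o t)%VF, pr x)).
Proof.
rewrite linfunE // => k u v; rewrite !linearP /=.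
by rewrite !comp_lfun_linearl sharp_linear.
Qed.

Lemma unglue_adj x w : d_omega (unglue x) w = omega g x (glue w).
Proof.
case: w => Z [A L]; rewrite unglueE glueE /= comp_lfunE flatE sharpE.
rewrite comp_lfunE flatE !linearDr /= (omega_anti x (q Z)) omega_q.
by ring.
Qed.

Lemma glue_isometry u v : omega g (glue u) (glue v) = d_omega u v.
Proof.
case: u v => [Z [A L]] [Z' [A' L']]; rewrite !glueE /=.
rewrite !linearDl /= !linearDr /= !omega_q !pr_q !pr_t !pr_s !linear0.
rewrite omega_tt omega_ts omega_ss !(omega_anti _ (q _)) !omega_q pr_t pr_s.
by rewrite !linear0 (omega_anti (s L)) omega_ts; ring.
Qed.

(** For an isometry, composing with the adjoint gives the identity, because the form on the source
    is non-degenerate. *)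
Lemma glueK : cancel glue unglue.
Proof.
by move=> u; apply: d_omega_inj => w; rewrite unglue_adj glue_isometry.
Qed.

Lemma unglue_q Z : unglue (q Z) = (Z, (0, 0)).
Proof.
have -> : q Z = glue (Z, (0, 0)) by rewrite glueE /= !linear0 !addr0.
exact: glueK.
Qed.

Lemma unglue_t A : unglue (t A) = (0, (A, 0)).
Proof.
have -> : t A = glue (0, (A, 0)) by rewrite glueE /= !linear0 add0r addr0.
exact: glueK.
Qed.

Lemma unglueK : cancel unglue glue.
Proof.
move=> x; have [Z [A [L ->]]] := qts_full x.
have -> : q Z + t A + s L = glue (Z, (A, L)) by rewrite glueE.
by rewrite glueK.
Qed.

Lemma unglue_isometry x y : d_omega (unglue x) (unglue y) = omega g x y.
Proof. by rewrite unglue_adj unglueK. Qed.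

(** * The cochain read off from the bracket *)

Definition glue_eps (L1 L2 : l) : 'Hom(l, K^o) :=
  (unglue (br g (s L1) (s L2))).1.
Definition glue_gam (L : l) (A : a) : 'Hom(l, K^o) :=
  (unglue (br g (s L) (t A))).1.
Definition glue_xi (L : l) (A : a) : a := (unglue (br g (s L) (t A))).2.1.

Let glue_eps_bilinear : bilinear_for *:%R *:%R glue_eps.
Proof.
by split=> w k u v; rewrite /glue_eps linearP ?linearPl ?linearPr linearP.
Qed.
HB.instance Definition _ := bilinear_isBilinear.Build K l l 'Hom(l, K^o)
  *:%R *:%R glue_eps glue_eps_bilinear.

Let glue_gam_bilinear : bilinear_for *:%R *:%R glue_gam.
Proof.
by split=> w k u v; rewrite /glue_gam linearP ?linearPl ?linearPr linearP.
Qed.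
HB.instance Definition _ := bilinear_isBilinear.Build K l a 'Hom(l, K^o)
  *:%R *:%R glue_gam glue_gam_bilinear.

Let glue_xi_bilinear : bilinear_for *:%R *:%R glue_xi.
Proof.
by split=> w k u v; rewrite /glue_xi linearP ?linearPl ?linearPr linearP.
Qed.
HB.instance Definition _ := bilinear_isBilinear.Build K l a a
  *:%R *:%R glue_xi glue_xi_bilinear.

Let glue_eps_alt L : glue_eps L L = 0.
Proof. by rewrite /glue_eps br_alt linear0. Qed.

Definition glue_cochain : cochain l a :=
  @Cochain K l a (curry_lfun glue_gam) glue_eps (curry_lfun glue_xi)
    glue_eps_alt.

Let glue_gamE L A : cc_gam glue_cochain L A = (unglue (br g (s L) (t A))).1.
Proof. exact: curry_lfunE. Qed.

Let glue_xiE L A : cc_xi glue_cochain L A = (unglue (br g (s L) (t A))).2.1.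
Proof. exact: curry_lfunE. Qed.

Let glue_gam_omega L A L' :
  cc_gam glue_cochain L A L' = omega g (br g (s L) (t A)) (s L').
Proof. by rewrite glue_gamE unglueE /= comp_lfunE flatE. Qed.

Let glue_xi_omega L A B :
  omega a (cc_xi glue_cochain L A) B = omega g (br g (s L) (t A)) (t B).
Proof. by rewrite glue_xiE unglueE /= sharpE comp_lfunE flatE. Qed.

Lemma unglue_br_st L A : unglue (br g (s L) (t A)) =
  (cc_gam glue_cochain L A, (cc_xi glue_cochain L A, 0)).
Proof. by rewrite glue_gamE glue_xiE [LHS]unglueE pr_br unglueE. Qed.

(** Closedness on [s L], [s L'], [t A] expresses the pairing of the bracket with [t A] through
    gamma, which is the defining formula of alpha. *)
Lemma unglue_br_ss L L' : unglue (br g (s L) (s L')) =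
  (cc_eps glue_cochain L L', (cc_alpha glue_cochain L L', 0)).
Proof.
rewrite [LHS]unglueE pr_br; congr (_, (_, _)).
  by rewrite /= /glue_eps unglueE.
apply: omega_inj => A; rewrite alphaE !glue_gam_omega sharpE comp_lfunE flatE.
have := omega_closed (s L) (s L') (t A); rewrite (br_anti (t A)) linearNl /=.
by move/eqP; rewrite -addrA addr_eq0 opprD opprK addrC => /eqP.
Qed.

(** The a-component is [split_br_tt]. Closedness on [t A], [t B], [s L] turns the l^*-component into
    the defining formula of beta. *)
Lemma unglue_br_tt A B : unglue (br g (t A) (t B)) =
  (cc_beta glue_cochain A B, (br a A B, 0)).
Proof.
rewrite [LHS]unglueE pr_br; congr (_, (_, _)); last first.
  by apply: omega_inj => C; rewrite sharpE comp_lfunE flatE br_tt.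
apply/lfunP => L; rewrite betaE (omega_anti A) !glue_xi_omega.
rewrite comp_lfunE flatE.
have := omega_closed (t A) (t B) (s L); rewrite (br_anti (t B)) linearNl /=.
by move/eqP; rewrite -addrA addr_eq0 opprD !opprK addrC => /eqP.
Qed.

Lemma unglue_br_ts A L : unglue (br g (t A) (s L)) =
  (- cc_gam glue_cochain L A, (- cc_xi glue_cochain L A, 0)).
Proof.
rewrite br_anti linearN /= unglue_br_st; congr (_, (_, _)).
by rewrite /= oppr0.
Qed.

Lemma unglue_br x y :
  unglue (br g x y) = d_br glue_cochain (unglue x) (unglue y).
Proof.
rewrite -{1}[x]unglueK -{1}[y]unglueK.
case: (unglue x) (unglue y) => [Z [A L]] [Z' [A' L']]; rewrite !glueE /=.
have q_centralr u Z0 : br g u (q Z0) = 0 by rewrite br_anti q_central oppr0.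
rewrite !linearDl /= !linearDr /= !q_central !q_centralr !add0r !linearD /=.
rewrite unglue_br_st unglue_br_tt unglue_br_ss unglue_br_ts.
congr (_, (_, _)); rewrite /= ?addr0 //.
  by rewrite -!addrA; congr (_ + _); rewrite addrCA.
by rewrite -!addrA; congr (_ + _); rewrite addrCA.
Qed.

Lemma glue_cocycle : cocycle glue_cochain.
Proof.
apply: cocycle_of_jacobi => u v w;
  rewrite -[u]glueK -[v]glueK -[w]glueK -!unglue_br.
  by rewrite -!linearD br_jacobi linear0.
by rewrite !unglue_isometry omega_closed.
Qed.

End Splitting.

(** * Construction of a splitting of a quadratic extension *)

Section Existence.
Variables (K : fieldType) (l : lieAlgebra K) (a : symplLie K).
Variable E : quadExt l a.
Hypothesis l_abelian : lie_abelian l.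
Hypothesis two_neq0 : 2%:R != 0 :> K.

Local Notation j := (qe_sub E).

Definition base_proj : 'Hom(E, l) :=
  (qe_p E \o (piv j : 'Hom(E, lie_quot (qe_ideal E))))%VF.

Lemma base_projE x : base_proj x = qe_p E (piv j x).
Proof. by rewrite comp_lfunE. Qed.

Lemma base_proj_br x y : base_proj (br E x y) = 0.
Proof.
by rewrite base_projE -(quot_brE (qe_ideal E)) qe_p_hom l_abelian.
Qed.

(** Exactness identifies the kernel of p with the image of j^perp. As j is isotropic, membership in
    j^perp depends only on the class modulo j. *)
Lemma base_proj_eq0 x : (base_proj x == 0) = (x \in orthov (omega E) j).
Proof.
rewrite base_projE -memv_ker -qe_exact qe_i_img.
apply/memv_imgP/idP => [[y yj]|xj]; last by exists x.
move/eqP; rewrite !pivE eq_quotv => xyj; rewrite -(subrK y x) memvD //.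
exact: (subvP (qe_isotropic E)).
Qed.

Definition dual_embed : 'Hom('Hom(l, K^o), E) :=
  linfun (fun Z : 'Hom(l, K^o) => sharp (Z \o base_proj)%VF : E).

Lemma omega_dual_embed Z x : omega E (dual_embed Z) x = Z (base_proj x).
Proof.
rewrite linfunE ?sharpE ?comp_lfunE // => k u v.
by rewrite comp_lfun_linearl sharp_linear.
Qed.

Lemma omega_sub x y : x \in j -> base_proj y = 0 -> omega E x y = 0.
Proof.
move=> xj /eqP; rewrite base_proj_eq0 omega_anti => /mem_orthovP -> //.
by rewrite oppr0.
Qed.

Definition section0 : 'Hom(l, E) := (base_proj^-1)%VF.

Lemma section0K : cancel section0 base_proj.
Proof.
move=> L; apply: limg_lfunVK; have := memvf L; rewrite -(qe_p_surj E).
case/memv_imgP => u _ ->; apply/memv_imgP; exists (repr u); rewrite ?memvf //.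
by rewrite base_projE pivE reprK.
Qed.

(** Pairing with an element of j kills j^perp, the kernel of [base_proj], so it factors through l;
    composing with any section gives the factor. *)
Lemma mem_dual_embed x : x \in j ->
  x = dual_embed (flat E x \o section0)%VF.
Proof.
move=> xj; apply: omega_inj => y; rewrite omega_dual_embed comp_lfunE flatE.
apply/eqP; rewrite -subr_eq0 -linearBr /= omega_sub // linearB /=.
by rewrite section0K subrr.
Qed.

Lemma base_proj_sub x : x \in j -> base_proj x = 0.
Proof.
by move=> xj; apply/eqP; rewrite base_proj_eq0 (subvP (qe_isotropic E)).
Qed.

(** A functional factoring through [base_proj] vanishes on j^perp, so the vector representing it
    lies in j^perp^perp. *)
Lemma dual_embed_sub Z : dual_embed Z \in j.
Proof.
apply: (subvP (orthov_orthov_sub j)); apply/mem_orthovP => x.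
by rewrite -base_proj_eq0 omega_dual_embed => /eqP ->; rewrite linear0.
Qed.

(* The correction by half the form makes the image of the section isotropic. *)
Definition isotropic_section : 'Hom(l, E) :=
  (section0 - 2%:R^-1 *: (dual_embed \o pull_form section0 section0))%VF.

Lemma isotropic_sectionE L : isotropic_section L = section0 L
  - 2%:R^-1 *: dual_embed (pull_form section0 section0 L).
Proof. by rewrite add_lfunE opp_lfunE scale_lfunE comp_lfunE. Qed.

Lemma base_proj_section L : base_proj (isotropic_section L) = L.
Proof.
rewrite isotropic_sectionE linearB linearZ /= section0K.
by rewrite (base_proj_sub (dual_embed_sub _)) scaler0 subr0.
Qed.

(** Each of the two corrections subtracts half of [omega E (section0 L) (section0 L')], and the
    corrections pair to zero with each other because [dual_embed] lands in j. *)
Lemma omega_section L L' :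
  omega E (isotropic_section L) (isotropic_section L') = 0.
Proof.
rewrite (isotropic_sectionE L') linearBr linearZr /=.
rewrite (omega_anti _ (dual_embed _)).
rewrite omega_dual_embed base_proj_section isotropic_sectionE.
rewrite linearBl linearZl_LR /= omega_dual_embed section0K !pull_formE.
rewrite (omega_anti (section0 L')).
by field.
Qed.

Definition lift0 : 'Hom(a, E) :=
  ((piv j : 'Hom(E, lie_quot (qe_ideal E)))^-1 \o qe_i E)%VF.

Lemma piv_lift0 A : piv j (lift0 A) = qe_i E A.
Proof.
rewrite comp_lfunE limg_lfunVK //; apply/memv_imgP.
by exists (repr (qe_i E A : quotv j)); rewrite ?memvf // pivE reprK.
Qed.

(** The subtracted element of j has the same pairings with s(l) as [lift0]. The result is therefore
    orthogonal to s(l), with unchanged class modulo j. *)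
Definition adapted_lift : 'Hom(a, E) :=
  (lift0 - (dual_embed \o pull_form lift0 isotropic_section))%VF.

Lemma adapted_liftE A : adapted_lift A =
  lift0 A - dual_embed (pull_form lift0 isotropic_section A).
Proof. by rewrite add_lfunE opp_lfunE [X in _ - X]comp_lfunE. Qed.

Lemma piv_lift A : piv j (adapted_lift A) = qe_i E A.
Proof.
rewrite adapted_liftE linearB /= piv_lift0.
have /eqP -> : piv j (dual_embed (pull_form lift0 isotropic_section A)) == 0.
  by rewrite piv_eq0 dual_embed_sub.
by rewrite subr0.
Qed.

Lemma base_proj_lift A : base_proj (adapted_lift A) = 0.
Proof.
rewrite base_projE piv_lift; apply/eqP; rewrite -memv_ker -qe_exact.
exact: memv_img (memvf A).
Qed.

Lemma omega_lift_section A L :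
  omega E (adapted_lift A) (isotropic_section L) = 0.
Proof.
rewrite adapted_liftE linearBl /= omega_dual_embed base_proj_section.
by rewrite pull_formE subrr.
Qed.

Lemma lift_orth A : adapted_lift A \in orthov (omega E) j.
Proof. by rewrite -base_proj_eq0 base_proj_lift. Qed.

Lemma omega_lift A B :
  omega E (adapted_lift A) (adapted_lift B) = omega a A B.
Proof.
rewrite -(qe_i_omega E) -!piv_lift.
by rewrite induced_omegaE ?qe_isotropic ?lift_orth.
Qed.

(** As i is a homomorphism, the lift respects brackets modulo j, and j is orthogonal to lifted
    elements. *)
Lemma omega_br_lift A B C :
  omega E (br E (adapted_lift A) (adapted_lift B)) (adapted_lift C)
  = omega a (br a A B) C.
Proof.
rewrite -omega_lift; apply/eqP; rewrite -subr_eq0 -linearBl /=.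
rewrite omega_sub ?base_proj_lift // -piv_eq0 linearB /=.
rewrite piv_lift (qe_i_hom E) -(quot_brE (qe_ideal E)) !piv_lift.
by rewrite subrr.
Qed.

Lemma dual_embed_central Z x : br E (dual_embed Z) x = 0.
Proof. exact/lie_centerP/(subvP (qe_central E))/dual_embed_sub. Qed.

Lemma adapted_decomposition x : exists Z A L,
  x = dual_embed Z + adapted_lift A + isotropic_section L.
Proof.
(* Removing the l-part leaves an element of j^perp; its class is some i(A), and removing the lift of
   [A] leaves an element of j. *)
pose y := x - isotropic_section (base_proj x).
have : qe_p E (piv j y) == 0.
  by rewrite -base_projE /y linearB /= base_proj_section subrr.
rewrite -memv_ker -qe_exact => /memv_imgP[A _ yA].
have yAj : y - adapted_lift A \in j.
  by rewrite -piv_eq0 linearB /= piv_lift -yA subrr.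
exists (flat E (y - adapted_lift A) \o section0)%VF, A, (base_proj x).
by rewrite -mem_dual_embed // subrK subrK.
Qed.

Lemma dual_embed_proj0 Z : base_proj (dual_embed Z) = 0.
Proof. exact/base_proj_sub/dual_embed_sub. Qed.

(** * The cocycle of the extension and the equivalence *)

Definition ext_cochain : cochain l a :=
  glue_cochain base_proj adapted_lift isotropic_section.

Lemma ext_splitting :
  splitting base_proj dual_embed adapted_lift isotropic_section.
Proof.
split; [exact: base_proj_br | exact: omega_dual_embed
  | exact: dual_embed_central | exact: dual_embed_proj0
  | exact: base_proj_lift | exact: base_proj_section | exact: omega_section
  | exact: omega_lift_section | exact: omega_lift | exact: omega_br_lift
  | exact: adapted_decomposition].
Qed.

Lemma ext_cocycle : cocycle ext_cochain.
Proof. exact: glue_cocycle ext_splitting. Qed.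

(** The equivalence is [unglue]. It carries j onto l^* and [adapted_lift A] to [A], and its
    l-component is [base_proj]; this gives compatibility with i and p. *)
Lemma ext_equiv : qe_equiv E (d_ext ext_cocycle l_abelian).
Proof.
pose f : 'Hom(E, d_sympl ext_cocycle) :=
  unglue base_proj adapted_lift isotropic_section.
have f_q Z : f (dual_embed Z) = (Z, (0, 0)).
  exact: unglue_q ext_splitting _.
have f_t A : f (adapted_lift A) = (0, (A, 0)).
  exact: unglue_t ext_splitting _.
have f_sub : (f @: j)%VS = dual_sub ext_cocycle.
  apply/vspaceP => u; rewrite mem_dual_sub; apply/memv_imgP/eqP.
    by case=> x /mem_dual_embed -> ->; rewrite f_q.
  by case: u => Z w /= ->; exists (dual_embed Z); rewrite ?dual_embed_sub.
have f_piv x : induced_map j (dual_sub ext_cocycle) f (piv j x)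
    = piv (dual_sub ext_cocycle) (f x).
  by apply: induced_mapE; rewrite f_sub.
exists f; split=> //.
- split.
  + exists (glue dual_embed adapted_lift isotropic_section).
    * exact: (unglueK ext_splitting).
    * exact: (glueK ext_splitting).
  + exact: (unglue_br ext_splitting).
  + exact: (unglue_isometry ext_splitting).
- by move=> A; rewrite -piv_lift [LHS]f_piv f_t [RHS]d_iE.
- move=> u; rewrite -[u]reprK -pivE [X in qe_p _ X]f_piv -base_projE.
  by rewrite [LHS]d_pE unglueE.
Qed.

End Existence.

(** * Balanced extensions have balanced cocycles *)

Section Balanced.
Variables (K : fieldType) (l : lieAlgebra K) (a : symplLie K).
Hypothesis l_abelian : lie_abelian l.

(** The center and its orthogonal are determined by bracket and form, so an isomorphism of
    symplectic Lie algebras transports both. *)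
Lemma qe_balanced_equiv (E F : quadExt l a) :
  qe_equiv E F -> qe_balanced E -> qe_balanced F.
Proof.
case=> f [[[f' fK f'K] f_hom f_omega] f_sub _ _] balE.
have f_center x : (f x \in lie_center F) = (x \in lie_center E).
  apply/lie_centerP/lie_centerP => xc y.
    by apply: (can_inj fK); rewrite f_hom xc linear0.
  by rewrite -[y]f'K -f_hom xc linear0.
rewrite /qe_balanced -f_sub balE; apply/vspaceP => u.
rewrite -[u]f'K; set x := f' u; rewrite memv_cap f_center.
have -> : (f x \in orthov (omega F) (lie_center F))
    = (x \in orthov (omega E) (lie_center E)).
  apply/mem_orthovP/mem_orthovP => xo y yc.
    by rewrite -f_omega xo // f_center.
  by rewrite -[y]f'K f_omega xo // -f_center f'K.
rewrite -memv_cap; apply/memv_imgP/idP => [[y yc /(can_inj fK) ->] //|xc].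
by exists x.
Qed.

Variables (c : cochain l a) (cP : cocycle c).

(** The four equations of condition (a) are the components of the vanishing of the brackets of A + L
    with a and with l. *)
Lemma d_center_of A L :
    ad a A + cc_xi c L = 0 ->
    (forall A', cc_gam c L A' + cc_beta c A A' = 0) ->
    (forall L', cc_alpha c L L' = cc_xi c L' A) ->
    (forall L', cc_eps c L L' = cc_gam c L' A) ->
  ((0, (A, L)) : d_sympl cP) \in lie_center (d_sympl cP).
Proof.
move=> adA gamA alphaL epsL; apply/lie_centerP => -[Z [A' L']].
have adA' : br a A A' + cc_xi c L A' = 0.
  by rewrite -[br a A A']curry_lfunE -add_lfunE adA zero_lfunE.
congr (_, (_, _)).
- by rewrite epsL subrK addrC gamA.
- by rewrite alphaL subrK.
Qed.

Lemma d_center_inv (x : d_sympl cP) : x \in lie_center (d_sympl cP) ->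
  [/\ ad a x.2.1 + cc_xi c x.2.2 = 0,
      forall A', cc_gam c x.2.2 A' + cc_beta c x.2.1 A' = 0,
      forall L', cc_alpha c x.2.2 L' = cc_xi c L' x.2.1 &
      forall L', cc_eps c x.2.2 L' = cc_gam c L' x.2.1].
Proof.
case: x => Z [A L] /lie_centerP xc /=.
have zeroE := (linear0, linear0r, linear0l, zero_lfunE, add0r, addr0, sub0r).
have xA A' : cc_gam c L A' + cc_beta c A A' = 0 /\ br a A A' + cc_xi c L A' = 0.
  by case: (xc (0, (A', 0))); rewrite !zeroE addrC.
have xL L' : cc_eps c L L' = cc_gam c L' A /\ cc_alpha c L L' = cc_xi c L' A.
  case: (xc (0, (0, L'))); rewrite !zeroE ![- _ + _]addrC => /eqP + /eqP.
  by rewrite !subr_eq0 => /eqP -> /eqP ->.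
split=> [|A'|L'|L'].
- apply/lfunP => A'; rewrite add_lfunE zero_lfunE curry_lfunE.
  by have [] := xA A'.
- by have [] := xA A'.
- by have [] := xL L'.
- by have [] := xL L'.
Qed.

(** Balancedness puts l^* inside the orthogonal of the center, so the center lies in the orthogonal
    of l^*, where the l-component is zero. *)
Lemma balanced_center (x : d_sympl cP) :
  qe_balanced (d_ext cP l_abelian) -> x \in lie_center (d_sympl cP) ->
  x.2.2 = 0.
Proof.
move=> bal xc; apply/eqP; rewrite -mem_orth_dual_sub; apply/mem_orthovP => z.
rewrite [dual_sub cP]bal memv_cap omega_anti => /andP[_ /mem_orthovP ->] //.
by rewrite oppr0.
Qed.

(** For (a), A + L is central, so L = 0. For (b), a vector A in the radical of the subspace is
    central and orthogonal to the center, hence lies in l^*, which forces A = 0. *)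
Lemma balanced_of_d_ext :
  qe_balanced (d_ext cP l_abelian) -> balanced_cocycle c.
Proof.
move=> bal; split=> //.
- move=> L [A [adA gamA alphaL epsL]].
  have xc := d_center_of adA gamA alphaL epsL.
  exact: (balanced_center bal xc).
- move=> A [/lie_centerP Ac betaA xiA gamA] A_orth.
  have xc : ((0, (A, 0)) : d_sympl cP) \in lie_center (d_sympl cP).
    apply: d_center_of => [|A'|L'|L'].
    + by apply/lfunP => A'; rewrite linear0 addr0 curry_lfunE Ac zero_lfunE.
    + by rewrite linear0 zero_lfunE add0r betaA.
    + by rewrite linear0l xiA.
    + by rewrite linear0l gamA.
  suff : ((0, (A, 0)) : d_sympl cP) \in dual_sub cP.
    by rewrite mem_dual_sub => /eqP [].
  rewrite [dual_sub cP]bal memv_cap xc; apply/mem_orthovP => -[Z [B L]] yc.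
  (* A central Z + B + L has L = 0, so its pairing with A is that of B with A, and the center
     equations put B in the subspace of (b). *)
  have [adB gamB alphaL epsL] := d_center_inv yc.
  have L0 : L = 0 := balanced_center bal yc.
  rewrite /= L0 !linear0 add0r addr0; apply: A_orth; subst L.
  move: adB gamB alphaL epsL; rewrite /= !linear0 addr0 => adB gamB alphaL epsL.
  split.
  + by apply/lie_centerP => A'; rewrite -curry_lfunE -/(ad a) adB zero_lfunE.
  + by move=> A'; rewrite -[RHS](gamB A') zero_lfunE add0r.
  + by move=> L; rewrite -alphaL linear0l.
  + by move=> L; rewrite -epsL linear0l.
Qed.

End Balanced.

Theorem theorem4 (R : realType) (l : lieAlgebra R) (a : symplLie R)
    (l_abelian : lie_abelian l) (E : quadExt l a) :
  (exists (c : cochain l a) (cP : cocycle c), qe_equiv E (d_ext cP l_abelian)) /\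
  (forall (c : cochain l a) (cP : cocycle c),
     qe_equiv E (d_ext cP l_abelian) -> qe_balanced E -> balanced_cocycle c).
Proof.
split=> [|c cP E_d E_bal].
  have two_neq0 : 2%:R != 0 :> R by rewrite Num.Theory.pnatr_eq0.
  exists (ext_cochain E), (ext_cocycle E l_abelian two_neq0).
  exact: ext_equiv.
(* Transport along the given equivalence covers every cocycle representing the extension, not only
   the constructed one. *)
exact: balanced_of_d_ext (qe_balanced_equiv E_d E_bal).
Qed.
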